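(* For all fixed integers $r\ge 3$ and $n\ge 2$, we have $$\lim_{q\to\infty}\frac{f_r^{q}(n)}{q^{\lceil\frac{(r-2)n}{r-1}\rceil}}=\frac{\binom{n}{\lceil\frac{(r-2)n}{r-1}\rceil}}{\binom{n}{\lceil\frac{(r-2)n}{r-1}\rceil}-m\left(n,\lfloor\frac{n}{r-1}\rfloor,\lambda\right)},$$ where $\lambda\in\{1,\ldots,r-1\}$ is the unique integer that satisfies $n+\lambda\equiv 0\pmod{r-1}$.
   Context: Write $[q]=\{1,\ldots,q\}$, where $q\ge 2$ is an integer. For $r\ge 3$, a family of $r$ distinct vectors $\boldsymbol{x}^0,\boldsymbol{x}^1,\ldots,\boldsymbol{x}^{r-1}\in[q]^n$ is an $r$-focal code with focus $\boldsymbol{x}^0$ if for every coordinate $i\in[n]$ we have $|\{j\in[r-1]:x_i^j=x_i^0\}|\ge r-2$. A code $\mathcal{C}\subseteq[q]^n$ is $r$-focal-free if it does not contain an $r$-focal code as a subset. $f_r^{q}(n)$ denotes the maximum cardinality of an $r$-focal-free code in $[q]^n$. A hypergraph is a family of distinct subsets (called edges) of its vertex set, and it is $s$-uniform if all its edges have exactly $s$ elements. $m(n,s,\lambda)$ denotes the maximum number of edges that can be contained in an $s$-uniform hypergraph on $n$ vertices that does not contain $\lambda$ pairwise disjoint edges.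
   Formalization: When n < r-1 the edges are empty; the empty edge is here counted as disjoint from itself, so m(n,0,λ)=0 and the limit is 1. With λ distinct edges required, m(n,0,λ)=1 for λ≥2 and the stated denominator would be 0 when n < r-2. *)

(* Defs.v *)
From mathcomp Require Import all_boot all_order all_algebra.

Set Implicit Arguments.
Unset Strict Implicit.
Unset Printing Implicit Defensive.

Import GRing.Theory Num.Theory.

(* The alphabet [q] is 'I_q and a word of [q]^n is a finite function. *)
Definition word (n q : nat) : finType := {ffun 'I_n -> 'I_q}.

(* X is the set {x^0, ..., x^(r-1)}; distinctness of the r vectors is the
   condition #|X| = r, and the indices j in [r-1] range over X :\ x0. *)
Definition focal_code_with_focus (r n q : nat) (X : {set word n q})
    (x0 : word n q) : bool :=
  [&& #|X| == r, x0 \in X &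
      [forall i : 'I_n, r - 2 <= #|[set x in X :\ x0 | x i == x0 i]|]].

Definition focal_code (r n q : nat) (X : {set word n q}) : bool :=
  [exists x0 : word n q, focal_code_with_focus r X x0].

Definition focal_free (r n q : nat) (C : {set word n q}) : bool :=
  [forall X : {set word n q}, (X \subset C) ==> ~~ focal_code r X].

Definition max_focal_free (r q n : nat) : nat :=
  \max_(C : {set word n q} | focal_free r C) #|C|.

Definition uniform (n s : nat) (H : {set {set 'I_n}}) : bool :=
  [forall e in H, #|e| == s].

(* The lam edges are an indexed family, pairwise disjoint at distinct indices.
   For s > 0 they are then automatically distinct; for s = 0 the empty edge is
   disjoint from itself, so the hypergraph {set0} contains lam pairwise
   disjoint edges for every lam. *)
Definition has_disjoint_edges (n lam : nat) (H : {set {set 'I_n}}) : bool :=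
  [exists e : {ffun 'I_lam -> {set 'I_n}},
    [forall i, e i \in H] &&
    [forall i, forall j, (i != j) ==> [disjoint e i & e j]]].

Definition max_uniform_edges (n s lam : nat) : nat :=
  \max_(H : {set {set 'I_n}} | uniform s H && ~~ has_disjoint_edges lam H) #|H|.

(* The ceiling is an integer; it is nonnegative here, so absz only converts it
   to nat. *)
Definition focal_exponent (r n : nat) : nat :=
  `|Num.ceil (((r - 2) * n)%:R / (r - 1)%:R : rat)%R|%N.

(* Main.v *)
(* Write k = r-1, s = floor(n/k), t = n-s, so that n + lam = k(s+1). A focal code
   with focus x is a set of k words whose difference sets from x are pairwise
   disjoint (and nonempty).

   Upper bound. Call S covered at x if some other codeword differs from x only
   inside S. Up to O(q^(t-1)) codewords x, all (s+1)-sets are covered at x; then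
   the covered s-sets have no lam disjoint members, since these could be completed
   by k - lam disjoint (s+1)-sets to a focal code. So x has at least C(n,s) - m
   uncovered s-sets S, and x is determined by S and its restriction to the
   complement of S.

   Lower bound. Let H be an extremal hypergraph. The gadget of H has a word for
   each z in [M]^H, whose i-th letter reads the z_S with i in S: two of its words
   differ on a set containing an edge, and S in H is exactly a complement of a
   t-set that does not see z_S. One packs gadgets, for all the hypergraphs g(H)
   with g a permutation, so that words of different gadgets agree on fewer than t
   coordinates; counting sizes, the union is focal-free. Instead of a random
   packing, gadgets are translated by the words of a Reed-Solomon code subject to
   one linear condition over F_p: for each t-set T, a linear form in the letters
   on T vanishes on the code, and on the gadgets it can be prescribed to be an
   injective function of what is visible on T. This is possible when the numbers
   of visible patterns add up to at most p, and is asymptotically lossless. A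
   Reed-Solomon factor over Z_N, with N = 1 mod n!, adapts the alphabet to q. *)
Require Import Defs.
From mathcomp Require Import all_boot all_order all_algebra all_fingroup.
From mathcomp Require Import zify ring lra.

Set Implicit Arguments.
Unset Strict Implicit.
Unset Printing Implicit Defensive.

Import Order.TTheory GRing.Theory Num.Theory.

(** * Focal codes and difference sets *)

Definition diffs (I : finType) (A : eqType) (x y : {ffun I -> A}) : {set I} :=
  [set i | x i != y i].

Lemma diffs_neq0 (I : finType) (A : eqType) (x y : {ffun I -> A}) :
  (diffs x y != set0) = (x != y).
Proof.
apply/negb_inj; rewrite !negbK; apply/eqP/eqP => [/setP d0|->].
  by apply/ffunP=> i; have := d0 i; rewrite !inE => /negbFE/eqP.
by apply/setP=> i; rewrite !inE eqxx.
Qed.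

Section Focal.
Variables (r n q : nat).
Implicit Types (x y : word n q) (C X : {set word n q}).

(** Agreement with [x0] in at least [r - 2] of the [r - 1] other words leaves at most one of them
    differing at each coordinate. *)
Lemma focal_disjointP X x0 : 2 <= r -> focal_code_with_focus r X x0 ->
  forall y z, y \in X :\ x0 -> z \in X :\ x0 -> y != z ->
  [disjoint diffs x0 y & diffs x0 z].
Proof.
move=> r2 /and3P[/eqP cX x0X /forallP agree] y z yX zX yz.
apply/pred0P=> i /=; apply/negP; rewrite !inE => /andP[yi zi].
have : #|[set x in X :\ x0 | x i == x0 i]| + #|[set y; z]| <= #|X :\ x0|.
  rewrite -cardsUI [X in _ + X](_ : _ = 0) ?addn0.
    apply/subset_leq_card/subsetP=> u /setUP[|/set2P[->|->]] //.
    by rewrite inE => /andP[].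
  apply/eqP; rewrite cards_eq0; apply/eqP/setP=> u.
  rewrite !inE; apply/negbTE/negP => /andP[/andP[_ /eqP ui]] /orP[] /eqP eu.
    by rewrite -ui eu eqxx in yi.
  by rewrite -ui eu eqxx in zi.
have := agree i; have := cardsD1 x0 X; rewrite cards2 yz x0X cX; lia.
Qed.

(** Distinctness of the [ys] comes from disjointness: a repeated word would give a nonempty
    difference set disjoint from itself. Disjointness also lets at most one word differ from [x0] at
    each coordinate. *)
Lemma focal_of_pairwise (C : {set word n q}) x0 (ys : seq (word n q)) :
  size ys = r.-1 -> 1 <= r -> x0 \in C ->
  all (fun y => (y \in C) && (y != x0)) ys ->
  pairwise (fun y z => [disjoint diffs x0 y & diffs x0 z]) ys ->
  ~~ focal_free r C.
Proof.
move=> sys r1 x0C /allP yC pw.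
have dn0 y : y \in ys -> diffs x0 y != set0.
  by move=> /yC /andP[_ yx0]; rewrite diffs_neq0 eq_sym.
have uys : uniq ys.
  rewrite uniq_pairwise; apply: (sub_in_pairwise (P := mem ys)) pw.
    move=> y z yin zin /= dis; apply: contraTneq dis => ->.
    by rewrite -setI_eq0 setIid dn0.
  exact/allP.
have dis y z : y \in ys -> z \in ys -> y != z ->
    [disjoint diffs x0 y & diffs x0 z].
  move=> yin zin yz.
  have sym : symmetric (fun y z => [disjoint diffs x0 y & diffs x0 z]).
    by move=> a b; rewrite disjoint_sym.
  elim: ys pw yin zin {sys yC dn0 uys} => //= a l IH /andP[/allP al pwl].
  rewrite !inE => /predU1P[ya|yl] /predU1P[za|zl].
  - by rewrite ya za eqxx in yz.
  - by rewrite ya; apply: al.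
  - by rewrite za sym; apply: al.
  - exact: IH.
apply/forallPn; exists (x0 |: [set y in ys]); rewrite negb_imply negbK.
have cX : #|x0 |: [set y in ys]| = r.
  rewrite cardsU1 cardsE (card_uniqP uys) inE sys.
  case: (boolP (x0 \in ys)) => [/yC|_]; last by lia.
  by rewrite eqxx andbF.
have XD : (x0 |: [set y in ys]) :\ x0 = [set y in ys].
  apply/setP=> y; rewrite !inE; case: eqVneq => [->|] //=.
  by apply/esym/negbTE/negP => /yC; rewrite eqxx andbF.
apply/andP; split.
  apply/subsetP=> y /setU1P[->//|]; rewrite inE => /yC /andP[] //.
apply/existsP; exists x0; rewrite /focal_code_with_focus cX eqxx setU11 /= XD.
apply/forallP=> i.
have : #|[set y in ys | y i != x0 i]| <= 1.
  apply/card_le1_eqP=> y z; rewrite !inE => /andP[yin yi] /andP[zin zi].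
  apply/eqP/negPn/negP=> yz; have /pred0P/(_ i) /= := dis _ _ zin yin yz.
  by rewrite !inE [x0 i == y i]eq_sym yi [x0 i == z i]eq_sym zi.
have := cardsID [set y : word n q | y i == x0 i] [set y in ys].
rewrite (_ : _ :&: _ = [set x in [set y0 in ys] | x i == x0 i]); last first.
  by apply/setP=> y; rewrite !inE.
rewrite (_ : _ :\: _ = [set y in ys | y i != x0 i]); last first.
  by apply/setP=> y; rewrite !inE andbC.
have -> : #|[set y in ys]| = r.-1 by rewrite cardsE (card_uniqP uys).
move=> sumA lt2; apply: (@leq_trans (r.-1 - 1)); first by lia.
by rewrite -sumA leq_subLR addnC leq_add2r.
Qed.

(* Of the r-1 pairwise disjoint difference sets of a focal code, at most lam-1
   contain an edge and the others have at least s+1 elements. *)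
Lemma focal_free_of_edges (s lam : nat) (C : {set word n q}) :
  2 <= r -> lam <= r.-1 -> n + lam = r.-1 * s.+1 ->
  (forall x, x \in C -> exists H : {set {set 'I_n}},
     [/\ uniform s H, ~~ has_disjoint_edges lam H &
      forall y, y \in C -> x != y ->
        s < #|diffs x y| \/ exists2 S, S \in H & S \subset diffs x y]) ->
  focal_free r C.
Proof.
move=> r2 lamr nlam edges; apply/forallP=> X; apply/implyP=> XC.
apply/existsP=> -[x0 foc].
have dis := focal_disjointP r2 foc.
have /and3P[/eqP cX x0X /forallP agree] := foc.
have x0C : x0 \in C by apply: (subsetP XC).
have [H [/forallP unif nodis sep]] := edges _ x0C.
pose Y := X :\ x0.
have cY : #|Y| = r.-1 by have := cardsD1 x0 X; rewrite x0X cX /Y; lia.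
have YP y : y \in Y -> y \in C /\ x0 != y.
  by rewrite !inE eq_sym => /andP[-> yX]; split=> //; apply: (subsetP XC).
pose Y1 := [set y in Y | [exists S in H, S \subset diffs x0 y]].
have cY1 : #|Y1| < lam.
  rewrite ltnNge; apply: contra nodis => lamY1.
  have [e0|[S0 S0in]] := set_0Vmem (H).
    have Y10 : Y1 = set0.
      apply/setP=> y; rewrite !inE; apply/negbTE/negP => /andP[_].
      by move=> /existsP[S]; rewrite e0 inE.
    have lam0 : lam = 0 by move: lamY1; rewrite Y10 cards0; lia.
    subst lam.
    apply/existsP; exists [ffun=> set0]; apply/andP; split; apply/forallP=> -[] //.
  pose S y := odflt set0 [pick S in H | S \subset diffs x0 y].
  have SP y : y \in Y1 -> S y \in H /\ S y \subset diffs x0 y.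
    rewrite !inE => /andP[_ /existsP[S1 /andP[S1H S1d]]]; rewrite /S.
    case: pickP => [S2 /andP[] //|/(_ S1)]; by rewrite S1H S1d.
  pose v (i : 'I_lam) := enum_val (widen_ord lamY1 i).
  have vY i : v i \in Y1 by apply: enum_valP.
  apply/existsP; exists [ffun i => S (v i)]; apply/andP; split.
    by apply/forallP=> i; rewrite ffunE; have [] := SP _ (vY i).
  apply/forallP=> i; apply/forallP=> j; apply/implyP=> ij; rewrite !ffunE.
  have [_ Si] := SP _ (vY i); have [_ Sj] := SP _ (vY j).
  apply: disjointWl Si _; apply: disjointWr Sj _; apply: dis.
  - by have := vY i; rewrite inE => /andP[].
  - by have := vY j; rewrite inE => /andP[].
  apply: contra ij => /eqP/enum_val_inj/(congr1 val) /= ij.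
  by apply/eqP/val_inj.
have sumD : \sum_(y in Y) #|diffs x0 y| <= n.
  rewrite -[leqRHS](card_ord n) -[leqRHS]sum1_card.
  rewrite (eq_bigr (fun y => \sum_(i < n) (x0 i != y i))); last first.
    move=> y _; rewrite -sum1_card big_mkcond /=; apply: eq_bigr => i _.
    by rewrite inE; case: (x0 i != y i).
  rewrite exchange_big /= leq_sum // => i _.
  rewrite -big_mkcondr sum1dep_card.
  apply/card_le1_eqP=> y z; rewrite !inE => /andP[yin yi] /andP[zin zi].
  apply/eqP/negPn/negP=> yz; have /pred0P/(_ i) : [disjoint diffs x0 z & diffs x0 y].
    by apply: dis; rewrite ?inE.
  by rewrite /= !inE yi zi.
(* As fewer than [lam] words lie in [Y1], these lower bounds add up to at least (r-1)(s+1) - (lam-1)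
   = n + 1, against [sumD]. *)
have low : \sum_(y in Y) (s + (y \notin Y1)) <= \sum_(y in Y) #|diffs x0 y|.
  apply: leq_sum => y yY; have [yC yx0] := YP _ yY.
  have [sz|[S SH Sd]] := sep _ yC yx0.
    by case: (y \notin Y1); lia.
  have -> : y \in Y1.
    by rewrite inE yY; apply/existsP; exists S; rewrite SH.
  rewrite addn0; have /implyP/(_ SH)/eqP <- := unif S; exact: subset_leq_card.
have cC : #|Y| <= #|Y1| + \sum_(y in Y) (y \notin Y1).
  rewrite -big_mkcondr sum1dep_card /= -leq_subLR.
  rewrite (_ : [set y | _ & _] = Y :\: Y1); last first.
    by apply/setP=> y; rewrite !inE /= andbC.
  by rewrite [leqRHS]cardsD leq_sub2l // subset_leq_card // subsetIr.
rewrite big_split /= sum_nat_const cY in low.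
rewrite cY in cC; have := leq_trans low sumD; move: cC cY1 nlam; rewrite mulnS.
move: (\sum_(y in Y) (y \notin Y1)) => Z; lia.
Qed.

End Focal.

(** * The upper bound *)

Notation pairwise_disjoint := (pairwise (fun A B : {set _} => [disjoint A & B])).

Lemma exists_disjoint_blocks (I : finType) (a b : nat) (A : {set I}) :
  a * b <= #|A| ->
  exists es : seq {set I}, [/\ size es = a,
    all (fun e : {set I} => (e \subset A) && (#|e| == b)) es &
    pairwise_disjoint es].
Proof.
elim: a A => [|a IH] A ab; first by exists [::].
pose e := [set x in take b (enum A)].
have eA : e \subset A.
  by apply/subsetP=> x; rewrite inE => /mem_take; rewrite mem_enum.
have ce : #|e| = b.
  rewrite cardsE (card_uniqP (take_uniq _ (enum_uniq _))) size_takel //.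
  by rewrite -cardE; nia.
have [|es [ses /allP aes pes]] := IH (A :\: e).
  by rewrite cardsD (setIidPr eA) ce; lia.
exists (e :: es); split=> /=; first by rewrite ses.
  rewrite eA ce eqxx; apply/allP=> f /aes; rewrite subsetD.
  by case/andP=> /andP[-> _] ->.
rewrite pes andbT; apply/allP=> f /aes; rewrite subsetD disjoint_sym.
by case/andP=> /andP[].
Qed.

Lemma has_disjoint_edgesP (n lam : nat) (H : {set {set 'I_n}}) :
  reflect (exists es : seq {set 'I_n}, [/\ size es = lam,
             {subset es <= H} & pairwise_disjoint es])
    (has_disjoint_edges lam H).
Proof.
apply: (iffP existsP) => [[e /andP[/forallP eH /forallP dis]]|].
  exists [seq e i | i <- enum 'I_lam]; split.
  - by rewrite size_map size_enum_ord.
  - by move=> _ /mapP[i _ ->].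
  have := enum_uniq 'I_lam; rewrite pairwise_map uniq_pairwise.
  by apply: sub_pairwise => i j; have /forallP/(_ j)/implyP := dis i.
case=> es [ses esH pes]; exists [ffun i : 'I_lam => nth set0 es i].
apply/andP; split; apply/forallP=> i.
  by rewrite ffunE esH // mem_nth // ses.
have/(pairwiseP set0) nthd := pes.
apply/forallP=> j; apply/implyP; rewrite !ffunE -val_eqE /= neq_ltn.
case/orP=> ij; last rewrite disjoint_sym; by apply: nthd; rewrite ?inE ?ses.
Qed.

(** Positivity of [lam] makes the empty hypergraph admissible, so the maximum runs over a nonempty
    family. *)
Lemma max_uniform_edges_attained (n s lam : nat) : 0 < lam ->
  exists H : {set {set 'I_n}}, [/\ uniform s H, ~~ has_disjoint_edges lam H &
    #|H| = max_uniform_edges n s lam].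
Proof.
move=> lam0.
have [|H /andP[uH nH] eH] := @eq_bigmax_cond _
  [pred H : {set {set 'I_n}} | uniform s H && ~~ has_disjoint_edges lam H]
  (fun H => #|H|).
  apply/card_gt0P; exists set0; rewrite inE; apply/andP; split.
    by apply/forallP=> e; rewrite inE.
  apply/has_disjoint_edgesP=> -[[|e es] [ses esH _]].
    by rewrite -ses in lam0.
  by have := esH e; rewrite !inE eqxx => /(_ isT).
by exists H; split=> //; apply: esym eH.
Qed.

Lemma uniform_subset n s (H : {set {set 'I_n}}) :
  uniform s H -> H \subset [set S : {set 'I_n} | #|S| == s].
Proof. by move=> /forallP uH; apply/subsetP=> e /(implyP (uH e)); rewrite inE. Qed.

(** The complete [s]-uniform hypergraph has [lam] disjoint edges, so an extremal one omits some
    [s]-set. This keeps the denominator of the limit positive. *)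
Lemma max_uniform_edges_lt (n s lam : nat) : 0 < lam -> lam * s <= n ->
  max_uniform_edges n s lam < 'C(n, s).
Proof.
move=> lam0 lams; have [H [uH /has_disjoint_edgesP nH <-]] :=
  max_uniform_edges_attained n s lam0.
have := subset_leqif_cards (uniform_subset uH).
rewrite card_draws card_ord => -[leH eqH]; rewrite ltn_neqAle eqH leH andbT.
apply/eqP=> eH; apply: nH; rewrite {}eH.
have [|es [ses /allP aes pes]] := @exists_disjoint_blocks 'I_n lam s setT.
  by rewrite cardsT card_ord.
exists es; split=> // e /aes /andP[_ ce]; by rewrite inE.
Qed.

Section Upper.
Variables (r n q s lam : nat).
Variable C : {set word n q}.
Hypotheses (r2 : 2 <= r) (lam0 : 0 < lam) (lamr : lam <= r.-1).
Hypothesis nlam : n + lam = r.-1 * s.+1.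
Hypothesis Cfree : focal_free r C.

Definition covered (x : word n q) (S : {set 'I_n}) : bool :=
  [exists y in C, (y != x) && (diffs x y \subset S)].

Lemma focal_of_covered x es : x \in C -> size es = r.-1 ->
  all (covered x) es -> pairwise_disjoint es -> False.
Proof.
move=> xC ses /allP aes pes.
pose f (S : {set _}) := odflt x [pick y in C | (y != x) && (diffs x y \subset S)].
have fP S : S \in es -> [/\ f S \in C, f S != x & diffs x (f S) \subset S].
  move=> /aes /existsP[y yP]; rewrite /f; case: pickP => [z /and3P[]|/(_ y)] //.
  by rewrite yP.
suff : ~~ focal_free r C by rewrite Cfree.
apply: (@focal_of_pairwise _ _ _ _ x (map f es)) => //.
- by rewrite size_map.
- exact: leq_trans r2.
- by apply/allP=> _ /mapP[S /fP[fC fx _] ->]; rewrite fC.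
rewrite pairwise_map; apply: (sub_in_pairwise (P := mem es)) pes.
  move=> S T /fP[_ _ fS] /fP[_ _ fT] /= dis.
  by apply: disjointWl fS _; apply: disjointWr fT _.
exact/allP.
Qed.

Lemma card_covered x : x \in C ->
  (forall S : {set 'I_n}, #|S| = s.+1 -> covered x S) ->
  #|[set S : {set 'I_n} | (#|S| == s) && covered x S]|
    <= max_uniform_edges n s lam.
Proof.
move=> xC cov; set H := [set S | _]; apply: leq_bigmax_cond.
apply/andP; split.
  by apply/forallP=> S; apply/implyP; rewrite inE => /andP[].
apply/has_disjoint_edgesP=> -[es [ses esH pes]].
pose A := \bigcup_(S <- es) S.
have cA : #|A| <= lam * s.
  rewrite -ses /A; elim: es esH {A ses pes} => [|S es IH] esH.
    by rewrite big_nil cards0.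
  have /andP[/eqP cS _] : (#|S| == s) && covered x S.
    by have := esH S; rewrite !inE eqxx => /(_ isT).
  rewrite big_cons /= mulSn; apply: leq_trans (leq_card_setU _ _) _.
  by rewrite cS leq_add2l IH // => T Tes; apply: esH; rewrite inE Tes orbT.
(* There is just enough room outside [A]: n - lam s = (r-1-lam)(s+1). *)
have [|fs [sfs /allP afs pfs]] :=
  @exists_disjoint_blocks 'I_n (r.-1 - lam) s.+1 (~: A).
  by rewrite cardsCs setCK card_ord; nia.
apply: (@focal_of_covered x (es ++ fs)) => //.
- by rewrite size_cat ses sfs subnKC.
- rewrite all_cat; apply/andP; split; apply/allP=> S.
    by move=> /esH; rewrite inE => /andP[].
  by move=> /afs /andP[_ /eqP]; apply: cov.
rewrite pairwise_cat pes pfs !andbT; apply/allrelP=> S T Ses /afs /andP[TA _].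
rewrite disjoint_sym; apply: disjointWl TA _.
rewrite disjoint_sym disjoints_subset setCK.
by rewrite /A (big_rem S) //= subsetUl.
Qed.

(** Another codeword with the same restriction to the complement of [S] would cover [S] at [x]. *)
Lemma card_uncovered (S : {set 'I_n}) :
  #|[set x in C | ~~ covered x S]| <= q ^ (n - #|S|).
Proof.
pose g (x : word n q) : {ffun {i | i \notin S} -> 'I_q} :=
  [ffun i => x (val i)].
have <- : #|{ffun {i | i \notin S} -> 'I_q}| = q ^ (n - #|S|).
  rewrite card_ffun card_ord card_sig; congr (_ ^ _).
  transitivity #|~: S|; first by apply: eq_card=> i; rewrite !inE.
  by rewrite cardsCs setCK card_ord.
rewrite -(card_in_imset (f := g)) ?max_card // => x y.
rewrite !inE => /andP[xC nx] /andP[yC _] gxy.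
apply/eqP; apply: contraR nx => xy; apply/existsP; exists y.
rewrite yC eq_sym xy; apply/subsetP=> i; rewrite inE.
apply: contraR => iS; have := congr1 (fun h : {ffun _} => h (Sub i iS)) gxy.
by rewrite /g !ffunE /= => ->.
Qed.

(** Double counting of pairs of a codeword and an [s]-set uncovered at it. Words with an uncovered
    set of size s+1 are set aside as [bad]; they account for the second term, of lower order in
    [q]. *)
Lemma card_focal_free :
  #|C| * ('C(n, s) - max_uniform_edges n s lam)
    <= 'C(n, s) * q ^ (n - s) + 'C(n, s.+1) * q ^ (n - s.+1) * 'C(n, s).
Proof.
set m := max_uniform_edges n s lam.
pose bad := [set x in C | [exists S : {set 'I_n},
  (#|S| == s.+1) && ~~ covered x S]].
have count k : \sum_(S : {set 'I_n} | #|S| == k) #|[set x in C | ~~ covered x S]|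
    <= 'C(n, k) * q ^ (n - k).
  rewrite -[n in 'C(n, _)]card_ord -card_draws -sum_nat_const.
  rewrite [leqRHS](eq_bigl (fun S : {set 'I_n} => #|S| == k)); last first.
    by move=> S; rewrite inE.
  by apply: leq_sum => S /eqP <-; apply: card_uncovered.
have cbad : #|bad| <= 'C(n, s.+1) * q ^ (n - s.+1).
  apply: leq_trans (count _).
  rewrite -sum1_card (eq_bigr (fun S : {set 'I_n} =>
    \sum_(x in C) ~~ covered x S)); last first.
    by move=> S _; rewrite -big_mkcondr sum1dep_card.
  rewrite exchange_big /= [leqRHS](bigID (mem bad)) /=.
  apply: leq_trans (leq_addr _ _).
  rewrite (eq_bigl (fun x => (x \in C) && (x \in bad))); last first.
    by move=> x; rewrite inE andbA andbb.
  apply: leq_sum => x /andP[_]; rewrite inE => /andP[_ /existsP[S /andP[cS nS]]].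
  by rewrite (bigD1 S) //= nS.
have good : (#|C| - #|bad|) * ('C(n, s) - m) <= 'C(n, s) * q ^ (n - s).
  apply: leq_trans (count s).
  rewrite (eq_bigr (fun S : {set 'I_n} =>
    \sum_(x in C) ~~ covered x S)); last first.
    by move=> S _; rewrite -big_mkcondr sum1dep_card.
  rewrite exchange_big /= [leqRHS](bigID (mem bad)) /=.
  apply: leq_trans (leq_addl _ _).
  rewrite -[X in X * _]cardsDS; last by apply/subsetP=> x; rewrite inE => /andP[].
  rewrite -sum_nat_const (eq_bigl (fun x => (x \in C) && (x \notin bad))); last first.
    by move=> x; rewrite inE andbC.
  apply: leq_sum => x /andP[xC xbad].
  have cov (S : {set 'I_n}) : #|S| = s.+1 -> covered x S.
    move=> /eqP cS; apply: contraR xbad => nS; rewrite inE xC.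
    by apply/existsP; exists S; rewrite cS.
  rewrite leq_subLR; apply: leq_trans (leq_add (card_covered xC cov) (leqnn _)).
  rewrite -big_mkcondr sum1dep_card -[n in 'C(n, _)]card_ord -card_draws.
  rewrite -(cardsID [set S | covered x S] [set S : {set 'I_n} | #|S| == s]).
  by apply: leq_add; apply: subset_leq_card; apply/subsetP=> S;
    rewrite !inE // andbC.
rewrite -(leq_add2r ('C(n, s.+1) * q ^ (n - s.+1) * 'C(n, s))) in good.
apply: leq_trans good; rewrite mulnBl; nia.
Qed.
End Upper.

(** * Additive codings *)

(** The weights are powers of [M], so the [z j] are base-[M] digits. In the induction the new
    element takes the units digit and the earlier weights are multiplied by [M]. *)
Lemma mixed_radix (J : finType) (M : nat) (A : {set J}) :
  exists w : J -> nat,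
    (forall z : {ffun J -> 'I_M}, \sum_(j in A) z j * w j < M ^ #|A|) /\
    (forall z z' : {ffun J -> 'I_M},
       \sum_(j in A) z j * w j = \sum_(j in A) z' j * w j -> {in A, z =1 z'}).
Proof.
have [d] := ubnP #|A|; elim: d A => // d IH A.
have [-> _|[a aA]] := set_0Vmem A.
  exists (fun=> 0); split=> [z|z z' _ j]; last by rewrite inE.
  by rewrite big_set0 cards0.
move=> cA; rewrite (cardsD1 a) aA in cA; rewrite -(setD1K aA).
have [w] := IH _ cA; move: {A aA cA}(A :\ a) (setD11 a A) => A /negbT aA [wlt winj].
pose v j := if j == a then 1 else M * w j.
have vE (z : {ffun J -> 'I_M}) :
    \sum_(j in a |: A) z j * v j = z a + M * \sum_(j in A) z j * w j.
  rewrite big_setU1 //= {1}/v eqxx muln1 big_distrr /=; congr (_ + _).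
  apply: eq_bigr => j jA; rewrite /v; case: eqVneq => [ja|_]; last by rewrite mulnCA.
  by rewrite -ja jA in aA.
exists v; split=> [z|z z'].
  by rewrite vE cardsU1 aA expnS; have := wlt z; have := ltn_ord (z a); nia.
rewrite !vE => eqz.
have [za zA] : z a = z' a :> nat /\
    \sum_(j in A) z j * w j = \sum_(j in A) z' j * w j.
  move: (ltn_ord (z a)) (ltn_ord (z' a)) eqz.
  move: (\sum_(j in A) z j * w j) (\sum_(j in A) z' j * w j) => s s'.
  by case: (ltngtP s s'); nia.
move=> j /setU1P[->|]; [exact: val_inj | exact: winj].
Qed.

Lemma disjoint_intervals (K : finType) (b : K -> nat) :
  exists off : K -> nat,
    (forall k, off k + b k <= \sum_k b k) /\
    (forall k k' x x', x < b k -> x' < b k' -> off k + x = off k' + x' -> k = k').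
Proof.
pose off (k : K) := \sum_(j | enum_rank j < enum_rank k) b j.
have offS k k' : enum_rank k < enum_rank k' -> off k + b k <= off k'.
  move=> kk'; rewrite /off [leqRHS](bigID (fun j => enum_rank j < enum_rank k)) /=.
  apply: leq_add.
    rewrite [leqRHS](eq_bigl (fun j => enum_rank j < enum_rank k)) // => j.
    by case: (ltnP (enum_rank j) (enum_rank k)) => h; rewrite ?andbF // (ltn_trans h).
  by rewrite (bigD1 k) ?leq_addr //= kk' ltnn.
exists off; split=> [k|k k' x x' xb xb' exx'].
  rewrite /off [leqRHS](bigID (fun j => enum_rank j < enum_rank k)) /=.
  by rewrite leq_add2l (bigD1 k) ?leq_addr //= ltnn.
case: (ltngtP (enum_rank k) (enum_rank k')) =>
  [/offS|/offS|/val_inj/enum_rank_inj //]; lia.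
Qed.

(** Each [k] owns an interval of length [M ^ #|A k|], inside which digits record [z]. The code is a
    sum with one term per [j] so that its terms can later be distributed over the coordinates of a
    t-set. *)
Lemma additive_coding (K J : finType) (M p : nat) (A : K -> {set J}) :
  \sum_k M ^ #|A k| <= p ->
  exists off_w : (K -> nat) * (K -> J -> nat),
    let code k (z : {ffun J -> 'I_M}) :=
      off_w.1 k + \sum_(j in A k) z j * off_w.2 k j in
    (forall k z, code k z < p) /\
    (forall k k' z z', code k z = code k' z' -> k = k' /\ {in A k, z =1 z'}).
Proof.
move=> le_p; have [off [off_le off_inj]] := disjoint_intervals (fun k => M ^ #|A k|).
have [w wP] := fin_all_exists (fun k => mixed_radix M (A k)).
exists (off, w) => /=; split=> [k z|k k' z z' ezz'].
  by have [wlt _] := wP k; have := off_le k; have := wlt z; lia.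
have [wlt winj] := wP k; have [wlt' _] := wP k'.
have kk' := off_inj _ _ _ _ (wlt z) (wlt' z') ezz'; subst k'.
by split=> //; apply: winj; lia.
Qed.

Lemma pigeonhole_fiber (A B : finType) (f : A -> B) : 0 < #|B| ->
  exists b, #|A| <= #|B| * #|[set a | f a == b]|.
Proof.
case/card_gt0P=> b0 _; pose F b := #|[set a | f a == b]|.
case: (@arg_maxnP _ b0 xpredT F) => // b _ bmax; exists b.
rewrite -/(F b) -sum_nat_const -sum1_card (partition_big f predT) //=.
by apply: leq_sum => c _; rewrite sum1dep_card; apply: bmax.
Qed.

(** * Linked Reed-Solomon codes *)

Local Open Scope ring_scope.

(** [g] equals its Lagrange interpolant, as the difference [h] has too many roots for its degree;
    the identity compares coefficients of degree [#|T|.-1]. *)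
Lemma divided_difference (F : fieldType) (I : finType) (T : {set I}) (x : I -> F)
    (g : {poly F}) :
  {in T &, injective x} -> (size g <= #|T|)%N -> (0 < #|T|)%N ->
  \sum_(i in T) g.[x i] * \prod_(j in T :\ i) (x i - x j)^-1 = g`_#|T|.-1.
Proof.
move=> xinj sg T0.
pose c i := g.[x i] * \prod_(j in T :\ i) (x i - x j)^-1.
pose L i : {poly F} := \prod_(j in T :\ i) ('X - (x j)%:P).
have sL i : i \in T -> size (L i) = #|T|.
  move=> iT; rewrite /L -big_enum size_prod_XsubC -cardE.
  by have := cardsD1 i T; rewrite iT => ->.
have mL i : L i \is monic by rewrite /L -big_enum monic_prod_XsubC.
pose h := g - \sum_(i in T) c i *: L i.
have sh : (size h <= #|T|)%N.
  rewrite (leq_trans (size_polyD _ _)) // geq_max sg size_polyN.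
  rewrite (leq_trans (size_sum _ _ _)) //; apply/bigmax_leqP => i iT.
  by rewrite (leq_trans (size_scale_leq _ _)) // sL.
have h0 : h = 0.
  apply: (@roots_geq_poly_eq0 _ _ [seq x i | i <- enum T]); last first.
  - by rewrite size_map -cardE.
  - rewrite map_inj_in_uniq ?enum_uniq // => i j; rewrite !mem_enum.
    exact: xinj.
  apply/allP=> _ /mapP[i iT ->]; rewrite mem_enum in iT.
  rewrite /root /h hornerD hornerN horner_sum (bigD1 i) //= big1 => [|j].
    rewrite addr0 hornerZ /L horner_prod -mulrA -big_split /= big1 ?mulr1 ?subrr //.
    move=> j; rewrite !inE => /andP[ji jT].
    rewrite hornerXsubC mulVf // subr_eq0; apply: contra ji => /eqP/xinj.
    by rewrite eq_sym => ->.
  case/andP=> jT ji; rewrite hornerZ /L horner_prod (bigD1 i) /=.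
    by rewrite hornerXsubC subrr mul0r mulr0.
  by rewrite !inE eq_sym ji.
have : h`_#|T|.-1 = 0 by rewrite h0 coef0.
rewrite /h coefB coef_sum => /eqP; rewrite subr_eq0 => /eqP ->.
apply: eq_bigr => i iT; rewrite coefZ.
have := monicP (mL i); rewrite lead_coefE sL // => ->; by rewrite mulr1.
Qed.

Section Interpolation.
Variables (p n t : nat).
Hypotheses (p_pr : prime p) (p_gt : (2 * n < p)%N).

(** A word carries one polynomial over F_p per sample, each with its own evaluation points. This
    variety of nodes lets one letter have prescribed pairings for all t-sets at once. *)
Definition sample : finType := ('I_n * {ffun 'I_n -> bool})%type.

(* With x_i = 0 at i = e.1, the inverse differences (x_i - x_j)^-1 are the
   distinct small integers 2j+1 and 2j+2, selected by the bit e.2 j. *)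
Definition sample_point (e : sample) (j : 'I_n) : 'F_p :=
  if j == e.1 then 0 else - ((2 * j + 1 + e.2 j)%N%:R)^-1.

Lemma natFp_eq0 k : (k%:R == 0 :> 'F_p) = (p %| k)%N.
Proof. by rewrite (dvdn_pcharf (pchar_Fp p_pr)). Qed.

Lemma sample_weight_neq0 (e : {ffun _ -> bool}) (j : 'I_n) :
  (2 * j + 1 + e j)%N%:R != 0 :> 'F_p.
Proof.
rewrite natFp_eq0 gtnNdvd ?addn1 ?addSn //; have := ltn_ord j.
by case: (e j) => /=; lia.
Qed.

Lemma natFp_inj a b : (a < p)%N -> (b < p)%N -> a%:R = b%:R :> 'F_p -> a = b.
Proof.
move=> ap bp /(congr1 val) /=.
by rewrite !val_Fp_nat ?modn_small // ; apply: prime_gt1.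
Qed.

Lemma sample_point_inj e : injective (sample_point e).
Proof.
have nz (j : 'I_n) := sample_weight_neq0 e.2 j.
move=> i j; rewrite /sample_point.
case: eqVneq => [->|_]; case: eqVneq => [->|_] //.
- by move/eqP; rewrite eq_sym oppr_eq0 invr_eq0 (negPf (nz j)).
- by move/eqP; rewrite oppr_eq0 invr_eq0 (negPf (nz i)).
move=> /oppr_inj/invr_inj/natFp_inj eij; apply: val_inj => /=.
have := ltn_ord i; have := ltn_ord j; move: eij.
by case: (e.2 i); case: (e.2 j) => /= eij ? ?; have := eij ltac:(lia) ltac:(lia); lia.
Qed.

(** The products are the divided-difference weights of node [i] in [T]. *)
Definition pairing (T : {set 'I_n}) (i : 'I_n) (u : {ffun sample -> 'F_p}) :
    'F_p :=
  \sum_e u e * \prod_(j in T :\ i) (sample_point e i - sample_point e j)^-1.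

(** Weights of a functional on functions of the bits: it takes the difference in bit [j] for [j] in
    [T :\ i], and the value at bit [false] for every other [j]. *)
Definition isolating_coef (T : {set 'I_n}) (i : 'I_n) (f : {ffun 'I_n -> bool}) :
    'F_p :=
  \prod_j (if j \in T :\ i then (-1) ^+ ~~ f j else (~~ f j)%:R).

(** A common solution of the equations [pairing T i u = tau T], supported on the samples based at
    [i], where the weights are products of small integers. *)
Definition dual_letter (i : 'I_n) (tau : {set 'I_n} -> 'F_p) :
    {ffun sample -> 'F_p} :=
  [ffun e : sample => if e.1 == i then
     \sum_(T : {set 'I_n} | (i \in T) && (#|T| == t)) tau T * isolating_coef T i e.2
   else 0].

(* Summing over the bits isolates T: the sum factors over the coordinates j, and
   a coordinate of T outside T' contributes 1 - 1. *)
Lemma sum_isolating_coef (T T' : {set 'I_n}) i :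
  i \in T -> i \in T' -> #|T| = #|T'| ->
  \sum_(f : {ffun 'I_n -> bool}) isolating_coef T i f *
     \prod_(j in T' :\ i) (2 * j + 1 + f j)%N%:R = (T == T')%:R.
Proof.
move=> iT iT' cT.
pose G (j : 'I_n) (b : bool) : 'F_p :=
  (if j \in T :\ i then (-1) ^+ ~~ b else (~~ b)%:R) *
  (if j \in T' :\ i then (2 * j + 1 + b)%N%:R else 1).
transitivity (\sum_(f : {ffun 'I_n -> bool}) \prod_j G j (f j)).
  apply: eq_bigr => f _; rewrite /isolating_coef.
  by rewrite [X in _ * X]big_mkcond /= -big_split.
rewrite -(bigA_distr_bigA G).
have Gsum j : \sum_b G j b = G j true + G j false by rewrite big_bool.
case: eqVneq => [eT|neT] /=.
  apply: big1 => j _; rewrite Gsum /G -eT; case: ifP => _ /=.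
    by rewrite addn0 addn1 expr0 expr1 mul1r mulN1r -natrB // subSnn.
  by rewrite !mulr1 add0r.
have /subsetPn[j jT jT'] : ~~ (T \subset T').
  by apply: contra neT => sT; rewrite eqEcard sT cT leqnn.
have ji : j != i by apply: contraNneq jT' => ->.
apply/eqP/prodf_eq0; exists j => //; rewrite Gsum /G !inE ji jT (negPf jT') /=.
by rewrite !mulr1 expr0 expr1 subrr.
Qed.

Lemma pairing_dual_letter (T : {set 'I_n}) i tau :
  i \in T -> #|T| = t -> pairing T i (dual_letter i tau) = tau T.
Proof.
move=> iT cT; rewrite /pairing.
transitivity (\sum_i' \sum_(f : {ffun 'I_n -> bool}) dual_letter i tau (i', f) *
    \prod_(j in T :\ i) (sample_point (i', f) i - sample_point (i', f) j)^-1).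
  by rewrite pair_bigA /=; apply: eq_bigr => -[].
rewrite (bigD1 i) //= [X in _ + X]big1 ?addr0; last first.
  by move=> i' ii'; apply: big1 => f _; rewrite ffunE /= (negPf ii') mul0r.
transitivity (\sum_(f : {ffun 'I_n -> bool})
    \sum_(S : {set 'I_n} | (i \in S) && (#|S| == t)) tau S *
     (isolating_coef S i f * \prod_(j in T :\ i) (2 * j + 1 + f j)%N%:R)).
  apply: eq_bigr => f _; rewrite ffunE /= eqxx mulr_suml.
  apply: eq_bigr => S _; rewrite mulrA; congr (_ * _); apply: eq_bigr => j.
  rewrite !inE => /andP[ji _]; rewrite /sample_point /= eqxx (negPf ji).
  by rewrite sub0r opprK invrK.
rewrite exchange_big /= (bigD1 T) ?iT ?cT ?eqxx //= [X in _ + X]big1 ?addr0.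
  by rewrite -mulr_sumr sum_isolating_coef // eqxx mulr1.
move=> S /andP[/andP[iS /eqP cS] ST].
by rewrite -mulr_sumr sum_isolating_coef ?cS ?cT // (negPf ST) mulr0.
Qed.

Lemma dual_letter_ext i tau tau' :
  (forall T : {set 'I_n}, i \in T -> #|T| = t -> tau T = tau' T) ->
  dual_letter i tau = dual_letter i tau'.
Proof.
move=> ett; apply/ffunP=> e; rewrite !ffunE; case: ifP => // _.
by apply: eq_bigr => T /andP[iT /eqP cT]; rewrite ett.
Qed.

Lemma pairingD T i u v : pairing T i (u + v) = pairing T i u + pairing T i v.
Proof.
by rewrite /pairing -big_split /=; apply: eq_bigr => e _; rewrite ffunE mulrDl.
Qed.

Definition rs_letter (c : {ffun sample -> 'rV['F_p]_t}) (i : 'I_n) :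
    {ffun sample -> 'F_p} :=
  [ffun e => (rVpoly (c e)).[sample_point e i]].

(** Each sample contributes the divided difference of a polynomial of degree below [t]. The total is
    the same for every [T], so one linear condition on [c] serves all t-sets. *)
Lemma sum_pairing_rs c (T : {set 'I_n}) : #|T| = t -> (0 < t)%N ->
  \sum_(i in T) pairing T i (rs_letter c i) = \sum_e (rVpoly (c e))`_t.-1.
Proof.
move=> cT t0; rewrite /pairing exchange_big /=; apply: eq_bigr => e _.
rewrite -{4}cT -(divided_difference (x := sample_point e)) ?cT ?size_poly //.
  by apply: eq_bigr => i _; rewrite ffunE.
by move=> i j _ _; apply: sample_point_inj.
Qed.

End Interpolation.

(** Even with zero divisors, roots whose differences are units are bounded in number by the degree.
    This covers both Z_N and F_p. *)
Lemma rVpoly_horner_inj (R : comUnitRingType) (I : finType) (T : {set I}) (t : nat)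
    (x : I -> R) (a b : 'rV[R]_t) : #|T| = t ->
  {in T &, forall i j, i != j -> x i - x j \is a GRing.unit} ->
  {in T, forall i, (rVpoly a).[x i] = (rVpoly b).[x i]} -> a = b.
Proof.
move=> cT xu eqab; apply: (can_inj (@rVpolyK _ _)); apply/eqP.
rewrite -subr_eq0; set P := _ - _.
have sP : (size P <= t)%N.
  by rewrite (leq_trans (size_polyD _ _)) // geq_max size_polyN !size_poly.
have rt : all (root P) [seq x i | i <- enum T].
  apply/allP=> _ /mapP[i iT ->]; rewrite mem_enum in iT.
  by rewrite /root /P hornerD hornerN eqab // subrr.
have un : uniq_roots [seq x i | i <- enum T].
  have : {subset enum T <= T} by move=> i; rewrite mem_enum.
  have := enum_uniq T; elim: (enum T) => //= i s IH /andP[nis us] sub.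
  rewrite IH // ?andbT => [|j js]; last by apply: sub; rewrite inE js orbT.
  apply/allP=> _ /mapP[j js ->]; rewrite /diff_roots mulrC eqxx /=.
  apply: xu; first by apply: sub; rewrite inE js orbT.
    by apply: sub; rewrite inE eqxx.
  by apply: contraNneq nis => <-.
apply: contraT => P0; have := max_ring_poly_roots P0 rt un.
by rewrite size_map -cardE cT ltnNge sP.
Qed.

(** Up to sign the difference is a positive integer below [n], hence a divisor of n!. *)
Lemma natZp_diff_unit (n N : nat) (i j : 'I_n) : (1 < N)%N -> coprime N n`! ->
  i != j -> i%:R - j%:R \is a @GRing.unit 'Z_N.
Proof.
move=> N1 cop; wlog ij : i j / (j < i)%N => [hw|_].
  rewrite -val_eqE /= neq_ltn => /orP[] h.
    by rewrite -unitrN opprB hw // -val_eqE /= neq_ltn h ?orbT.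
  by rewrite hw // -val_eqE /= neq_ltn h orbT.
rewrite -natrB 1?ltnW // unitZpE //; apply: coprime_dvdr cop.
by apply: dvdn_fact; have := ltn_ord i; lia.
Qed.

Section Packing.
Variables (n t p N M : nat) (K J : finType) (B : K -> J -> {set 'I_n}).
Hypotheses (p_pr : prime p) (p_gt : (2 * n < p)%N) (t_gt0 : (0 < t)%N).
Hypotheses (N_gt1 : (1 < N)%N) (N_coprime : coprime N n`!).

Definition meeting (T : {set 'I_n}) (k : K) : {set J} :=
  [set j | B k j :&: T != set0].

Definition letter : finType := ('Z_N * {ffun sample n -> 'F_p})%type.

Hypothesis capacity : forall T : {set 'I_n}, #|T| = t ->
  (\sum_k M ^ #|meeting T k| <= p)%N.

(* Reed-Solomon words translated by gadget words: c carries the polynomials and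
   (k, z) the gadget, whose letters are chosen so that the pairings over any
   t-set T add up to an injective code of k and of the z j with B k j meeting T.
   Pinning the total leading coefficient of c makes that code readable from the
   restriction of the word to T. *)
Lemma packing_words_exist :
  exists (P : finType) (x : P -> K -> {ffun J -> 'I_M} -> {ffun 'I_n -> letter}),
    ((N * p ^ #|sample n|) ^ t <= p * #|P|)%N /\
    forall (T : {set 'I_n}) c k z c' k' z', #|T| = t ->
      {in T, x c k z =1 x c' k' z'} ->
      [/\ c = c', k = k' & forall j, B k j :&: T != set0 -> z j = z' j].
Proof.
have /fin_all_exists[ow owP] (T : {set 'I_n}) :
    exists off_w : (K -> nat) * (K -> J -> nat), #|T| = t ->
    let code k (z : {ffun J -> 'I_M}) :=
      (off_w.1 k + \sum_(j in meeting T k) z j * off_w.2 k j)%N in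
    (forall k z, code k z < p)%N /\
    (forall k k' z z', code k z = code k' z' -> k = k' /\ {in meeting T k, z =1 z'}).
  have [cT|cT] := eqVneq #|T| t.
    by have [ow owP] := additive_coding (capacity cT); exists ow.
  by exists (fun=> 0%N, fun _ _ => 0%N) => /eqP; rewrite (negPf cT).
(* The code of [T] is split among its coordinates: the offset goes to one chosen point of [T], and
   the term of [j] to one chosen point of [B k j :&: T]. *)
pose tau k (z : {ffun J -> 'I_M}) (T : {set 'I_n}) (i : 'I_n) : nat :=
  ((if [pick i in T] == Some i then (ow T).1 k else 0) +
   \sum_(j | [pick i in B k j :&: T] == Some i) z j * (ow T).2 k j)%N.
have sum_tau k z (T : {set 'I_n}) : #|T| = t -> (\sum_(i in T) tau k z T i =
    (ow T).1 k + \sum_(j in meeting T k) z j * (ow T).2 k j)%N.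
  move=> cT; rewrite big_split /=; congr (_ + _)%N.
    case: pickP => [i0 i0T|T0]; last by have := t_gt0; rewrite -cT (eq_card0 T0).
    rewrite (bigD1 i0) //= eqxx big1 ?addn0 // => i /andP[_ ii0].
    by case: eqP => // -[ei]; rewrite ei eqxx in ii0.
  rewrite (exchange_big_dep xpredT) //= [RHS]big_mkcond /=.
  apply: eq_bigr => j _; rewrite inE; case: pickP => [i0 i0BT|S0].
    have -> : B k j :&: T != set0 by apply/set0Pn; exists i0.
    rewrite (big_pred1 i0) // => i /=; rewrite eq_sym (inj_eq Some_inj).
    by case: eqVneq => [->|]; rewrite ?andbF // andbT; case/setIP: i0BT.
  rewrite big_pred0 => [|i]; last by rewrite andbF.
  by case: set0Pn => // -[i]; rewrite S0.
(* The share at [i], for any set [S], involves only those [z j] whose block contains [i]. *)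
have tauE k (z z' : {ffun J -> 'I_M}) (S T : {set 'I_n}) i :
    {in meeting T k, z =1 z'} -> i \in T -> tau k z S i = tau k z' S i.
  move=> zz' iT; congr (_ + _)%N; apply: eq_bigr => j.
  case: pickP => // i0 /setIP[i0B _] /eqP[ei]; rewrite zz' // inE.
  by apply/set0Pn; exists i; rewrite inE -{1}ei i0B.
pose gad k z i := dual_letter (p := p) t i (fun T => (tau k z T i)%:R).
pose lead (c : 'rV['Z_N]_t * {ffun sample n -> 'rV['F_p]_t}) :=
  \sum_e (rVpoly (c.2 e))`_t.-1.
(* The most frequent value [kap] of [lead] keeps at least a fraction 1/p of the polynomials. *)
have [|kap kapP] := pigeonhole_fiber lead.
  by rewrite card_Fp // prime_gt0.
exists {c | lead c == kap}.
exists (fun c k z => [ffun i : 'I_n => ((rVpoly (val c).1).[i%:R],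
   rs_letter (val c).2 i + gad k z i)]).
split.
  rewrite card_sig; rewrite card_Fp // in kapP; apply: leq_trans (leq_trans _ kapP) _.
    have cZ : #|{: 'rV['Z_N]_t}| = (N ^ t)%N.
      by rewrite card_mx mul1n card_ord Zp_cast.
    have cF : #|{: 'rV['F_p]_t}| = (p ^ t)%N.
      by rewrite card_mx mul1n card_Fp.
    apply: (@leq_trans (N ^ t * (p ^ t) ^ #|sample n|)).
      by rewrite expnMn -!expnM [(t * _)%N]mulnC.
    rewrite -{1}cZ -{1}cF -card_ffun -card_prod; exact: leqnn.
  by rewrite leq_mul2l cardsE leqnn orbT.
move=> T [c /= cP] k z [c' /= c'P] k' z' cT eqx.
have eq2 : {in T, forall i, rs_letter c.2 i + gad k z i =
                            rs_letter c'.2 i + gad k' z' i}.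
  by move=> i iT; have := eqx i iT; rewrite !ffunE => -[].
have pair_word d l y : lead d == kap ->
    \sum_(i in T) pairing T i (rs_letter d.2 i + gad l y i) =
    kap + (\sum_(i in T) tau l y T i)%N%:R.
  move=> /eqP <-; rewrite (eq_bigr _ (fun i _ => pairingD _ _ _ _)) big_split /=.
  rewrite sum_pairing_rs // natr_sum; congr (_ + _).
  by apply: eq_bigr => i iT; rewrite pairing_dual_letter.
have [code_lt code_inj] := owP T cT.
(* After [kap] is cancelled the two codes agree in F_p, hence as integers because both are below
   [p]. *)
have [kk' zz'] : k = k' /\ {in meeting T k, z =1 z'}.
  apply: code_inj; apply: (natFp_inj p_pr); rewrite ?code_lt // -!sum_tau //.
  apply: (addrI kap); rewrite -(pair_word _ _ _ cP) -(pair_word _ _ _ c'P).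
  by apply: eq_bigr => i iT; rewrite eq2.
subst k'.
(* The gadget letters on [T] now cancel, and interpolation on [T] recovers the polynomials. *)
have eq_gad i : i \in T -> gad k z i = gad k z' i.
  by move=> iT; apply: dual_letter_ext => S _ _; rewrite (tauE _ _ _ _ T _ zz').
split=> // [|j jT]; last by apply: zz'; rewrite inE.
apply: val_inj => /=; move: cP c'P eqx eq2 {pair_word}.
case: c c' => [a b] [a' b'] /= _ _ eqx eq2; congr pair.
  apply: (rVpoly_horner_inj (x := fun i : 'I_n => i%:R) cT) => [i j _ _|i iT].
    exact: natZp_diff_unit.
  by have := eqx i iT; rewrite !ffunE => -[].
apply/ffunP=> e; apply: (rVpoly_horner_inj (x := sample_point p e) cT).
  move=> i j _ _ ij; rewrite unitfE subr_eq0; apply: contra ij => /eqP.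
  by move/(sample_point_inj p_pr p_gt)=> ->.
move=> i iT; have := eq2 i iT; rewrite eq_gad // => /addIr/ffunP/(_ e).
by rewrite !ffunE.
Qed.
End Packing.

Local Close Scope ring_scope.

(** * The lower bound *)

Lemma exists_subset_card (I : finType) (A : {set I}) (k : nat) : k <= #|A| ->
  exists2 T : {set I}, T \subset A & #|T| = k.
Proof.
move=> kA; have [|[|T es] [//= _ /andP[/andP[TA /eqP cT] _] _]] :=
  @exists_disjoint_blocks _ 1 k A; first by rewrite mul1n.
by exists T.
Qed.

(** Induction on [#|S :\: T|]: a transposition exchanges a point of [S] outside [T] with a point of
    [T] outside [S]. *)
Lemma exists_perm_imset (I : finType) (S T : {set I}) : #|S| = #|T| ->
  exists g : {perm I}, g @: S = T.
Proof.
have [d] := ubnP #|S :\: T|; elim: d S => // d IH S dS cST.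
have [S_T|] := boolP (S \subset T).
  exists 1%g; have /eqP -> : S == T by rewrite eqEcard S_T cST leqnn.
  by rewrite -[RHS]imset_id; apply: eq_imset => i; rewrite perm1.
case/subsetPn=> a aS aT; have [b bT bS] : exists2 b, b \in T & b \notin S.
  apply/subsetPn; apply: contra aT => T_S.
  by have /eqP -> : T == S by rewrite eqEcard T_S cST leqnn.
have [||g gT] := IH (tperm a b @: S).
- have sub : tperm a b @: S :\: T \subset (S :\: T) :\ a.
    apply/subsetP=> _ /setDP[/imsetP[i iS ->]].
    case: tpermP => [_|ib|ia ib iT]; rewrite ?bT //.
      by rewrite -ib iS in bS.
    by rewrite !inE iT iS !andbT; apply/eqP.
  have := subset_leq_card sub; have := cardsD1 a (S :\: T).
  by rewrite inE aS aT /=; lia.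
- by rewrite card_imset //; apply: perm_inj.
exists (tperm a b * g)%g; rewrite -gT -imset_comp; apply: eq_imset => i.
by rewrite permM.
Qed.

Section Orbits.
Variables (n s : nat) (H : {set {set 'I_n}}).
Hypothesis Hs : uniform s H.

Definition hits (S : {set 'I_n}) : {set {perm 'I_n}} :=
  [set g : {perm 'I_n} | S \in [set g @: (e : {set 'I_n}) | e in H]].

(** By transitivity on [s]-sets the count does not depend on [S]; then pairs of a permutation [g]
    and an edge of g(H) are counted in two ways. *)
Lemma card_hits (S : {set 'I_n}) : #|S| = s -> #|hits S| * 'C(n, s) = n`! * #|H|.
Proof.
move=> cS; have const (T : {set 'I_n}) : #|T| = s -> #|hits T| = #|hits S|.
  rewrite -cS => /exists_perm_imset[g gT].
  rewrite -(card_imset (mem (hits T)) (@mulIg _ g)); apply: eq_card => h.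
  apply/imsetP/idP=> [[f fT ->]|hS].
    move: fT; rewrite !inE => /imsetP[e eH Te]; apply/imsetP; exists e => //.
    rewrite -gT Te -imset_comp; apply: eq_imset => i; by rewrite permM.
  exists (h * g^-1)%g; last by rewrite mulgKV.
  move: hS; rewrite !inE => /imsetP[e eH Se]; apply/imsetP; exists e => //.
  rewrite (eq_imset (g := g^-1%g \o h)) => [|i]; last by rewrite permM.
  rewrite imset_comp -Se -gT -imset_comp -[LHS]imset_id; apply: eq_imset => i.
  by rewrite /= permK.
have cP : #|{perm 'I_n}| = n`! by rewrite card_Sn.
transitivity (\sum_(T : {set 'I_n} | #|T| == s) #|hits T|).
  rewrite (eq_bigr (fun=> #|hits S|)) => [|T /eqP]; last exact: const.
  rewrite sum_nat_const mulnC; congr (_ * _).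
  rewrite -[n in 'C(n, _)]card_ord -card_draws; apply: eq_card => T.
  by rewrite inE.
rewrite -cP -sum_nat_const.
rewrite (eq_bigr (fun T : {set 'I_n} => \sum_(g : {perm 'I_n})
  (T \in [set g @: (e : {set 'I_n}) | e in H]))); last first.
  move=> T _; rewrite -sum1_card big_mkcond; apply: eq_bigr => g _ /=.
  by rewrite /hits inE; case: ifP.
rewrite exchange_big /=; apply: eq_bigr => g _.
rewrite -big_mkcondr sum1dep_card -[RHS](card_imset _ (imset_inj (@perm_inj _ g))).
apply: eq_card => T; rewrite !inE andb_idl // => /imsetP[e eH ->].
by rewrite card_imset; [apply: (implyP (forallP Hs e)) | apply: perm_inj].
Qed.

End Orbits.

Section Lower.
Variables (r n s lam : nat).
Hypotheses (r2 : 2 <= r) (lam0 : 0 < lam) (lamr : lam <= r.-1).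
Hypotheses (nlam : n + lam = r.-1 * s.+1) (s_lt_n : s < n).
Variables (p q N M kappa v : nat).
Hypotheses (p_pr : prime p) (p_gt : 2 * n < p).
Hypotheses (N_gt1 : 1 < N) (N_coprime : coprime N n`!).
Let m := max_uniform_edges n s lam.
Hypothesis vP : v * 'C(n, s) = n`! * m.
Hypothesis capacity : kappa * ((n`! - v) * M ^ m + v * M ^ m.-1) <= p.
Hypothesis alphabet : N * p ^ #|sample n| <= q.

(** Each permuted gadget is used [kappa] times. The factor [p] on the right is the price of pinning
    the leading coefficient. *)
Lemma max_focal_free_ge :
  (N * p ^ #|sample n|) ^ (n - s) * (kappa * n`! * M ^ m)
    <= p * max_focal_free r q n.
Proof.
have [H [uH nH cH]] := max_uniform_edges_attained n s lam0.
pose t := n - s; have t0 : 0 < t by rewrite subn_gt0.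
pose K : finType := ({perm 'I_n} * 'I_kappa)%type.
pose J : finType := {S | S \in H}.
pose B (k : K) (j : J) : {set 'I_n} := k.1 @: val j.
have cJ : #|J| = m by rewrite card_sig /m -cH; apply: eq_card.
have cB k j : #|B k j| = s.
  rewrite /B card_imset; last exact: perm_inj.
  by have /implyP/(_ (valP j))/eqP := forallP uH (val j).
have cap (T : {set 'I_n}) : #|T| = t -> \sum_k M ^ #|meeting B T k| <= p.
  move=> cT; apply: leq_trans capacity.
  have cTC : #|~: T| = s by rewrite cardsCs setCK card_ord cT subKn // ltnW.
  have cv : #|hits H (~: T)| = v.
    have := card_hits uH cTC; rewrite cH -/m -vP => /eqP.
    by rewrite eqn_pmul2r ?bin_gt0 1?ltnW // => /eqP.
  (* An edge and [~: T] both have [s] elements, so the edge misses [T] only when they are equal: at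
     most one [z j] is invisible on [T]. *)
  have cm k : #|meeting B T k| = m - (k.1 \in hits H (~: T)).
    have -> : meeting B T k = ~: [set j | B k j == ~: T].
      apply/setP=> j; rewrite !inE; congr (~~ _).
      by rewrite setI_eq0 disjoints_subset eqEcard cB cTC leqnn andbT.
    rewrite cardsCs setCK cJ; congr (_ - _).
    rewrite inE; case: imsetP => [[e eH Te]|nT] /=.
      apply/eqP/cards1P; exists (Sub e eH); apply/setP=> j; rewrite !inE Te /B.
      by rewrite (inj_eq (imset_inj (@perm_inj _ _))) -val_eqE.
    apply/eqP; rewrite cards_eq0; apply/eqP/setP=> j; rewrite !inE.
    by apply/negbTE/eqP => eB; apply: nT; exists (val j); rewrite ?(valP j).
  rewrite (eq_bigr _ (fun k _ => congr1 (expn M) (cm k))).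
  rewrite -(pair_bigA _ (fun g (_ : 'I_kappa) => M ^ (m - (g \in hits H (~: T))))) /=.
  rewrite (eq_bigr _ (fun g _ => sum_nat_const _ _)) -big_distrr /= card_ord.
  rewrite leq_mul2l; apply/orP; right.
  rewrite (bigID (mem (hits H (~: T)))) /= addnC; apply: leq_add.
    rewrite (eq_bigr (fun=> M ^ m)) => [|g /negbTE ->]; last by rewrite subn0.
    rewrite sum_nat_const leq_mul2r -cv; apply/orP; right.
    have := cardsC (hits H (~: T)); rewrite card_Sn => <-.
    rewrite addKn; apply/eq_leq/eq_card => g; by rewrite [RHS]in_setC.
  rewrite (eq_bigr (fun=> M ^ m.-1)) => [|g ->]; last by rewrite subn1.
  by rewrite sum_nat_const cv.
have [P [x [cP xP]]] := packing_words_exist p_pr p_gt t0 N_gt1 N_coprime cap.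
(* To pass from t-sets to larger agreement sets, a block meeting [A] at [i] is read on a t-subset of
   [A] through [i]. *)
have xA (A : {set 'I_n}) c k z c' k' z' : t <= #|A| ->
    {in A, x c k z =1 x c' k' z'} ->
    [/\ c = c', k = k' & forall j, B k j :&: A != set0 -> z j = z' j].
  move=> tA eqx.
  have [T TA cT] := exists_subset_card tA.
  have [] := xP T c k z c' k' z' cT (sub_in1 (subsetP TA) eqx).
  move=> ec ek _; split=> // j /set0Pn[i /setIP[iB iA]].
  have [|U UA cU] := @exists_subset_card _ (A :\ i) t.-1.
    by have := cardsD1 i A; rewrite iA; lia.
  have iU : i \notin U by apply/negP=> /(subsetP UA); rewrite !inE eqxx.
  have [||_ _] := xP (i |: U) c k z c' k' z'; last first.
  - by apply; apply/set0Pn; exists i; rewrite inE iB setU11.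
  - move=> i' /setU1P[->|/(subsetP UA)]; first exact: eqx.
    by case/setD1P=> _; apply: eqx.
  by rewrite cardsU1 iU cU; lia.
(* An empty edge, repeated [lam] times, would be a forbidden disjoint family. Hence every [z j] is
   visible on the full word. *)
have B0 k j : B k j != set0.
  rewrite -card_gt0 cB lt0n; apply: contra nH => /eqP s0.
  have e0 : val j = set0.
    by apply/eqP; rewrite -cards_eq0 -s0; apply: (implyP (forallP uH _)); apply: valP.
  apply/has_disjoint_edgesP; exists (nseq lam set0); split.
  - exact: size_nseq.
  - by move=> e /nseqP[-> _]; rewrite -e0 (valP j).
  elim: (lam) => //= d ->; rewrite andbT; apply/allP=> e /nseqP[-> _].
  by rewrite -setI_eq0 setI0.
have card_letter : #|letter n p N| <= q.
  by rewrite card_prod card_ffun card_Fp // card_ord Zp_cast.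
pose emb (a : letter n p N) : 'I_q := widen_ord card_letter (enum_rank a).
have emb_inj : injective emb.
  by move=> a b /(congr1 val) /= /val_inj/enum_rank_inj.
pose w (u : P * K * {ffun J -> 'I_M}) : word n q :=
  [ffun i => emb (x u.1.1 u.1.2 u.2 i)].
have wA u u' i : w u i = w u' i -> x u.1.1 u.1.2 u.2 i = x u'.1.1 u'.1.2 u'.2 i.
  by rewrite !ffunE => /emb_inj.
have w_inj : injective w.
  move=> [[c k] z] [[c' k'] z'] eww.
  have [||-> -> ezz] := xA setT c k z c' k' z'.
  - by rewrite cardsT card_ord leq_subr.
  - by move=> i _; apply: (wA (c, k, z) (c', k', z')); rewrite eww.
  by congr (_, _); apply/ffunP=> j; apply: ezz; rewrite setIT.
pose C : {set word n q} := [set w u | u in predT].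
have cC : #|C| = #|P| * (n`! * kappa) * M ^ m.
  by rewrite card_imset // !card_prod card_ffun !card_ord cJ card_Sn.
have Cfree : focal_free r C.
  apply: (focal_free_of_edges r2 lamr nlam) => _ /imsetP[[[c k] z] _ ->].
  have gK (e : {set 'I_n}) : k.1^-1%g @: (k.1 @: e) = e.
    rewrite -imset_comp -[RHS]imset_id; apply: eq_imset => i.
    by rewrite /= permK.
  exists [set k.1 @: (e : {set 'I_n}) | e in H]; split.
  - apply/forallP=> e; apply/implyP=> /imsetP[f fH ->].
    by rewrite card_imset; [apply: (implyP (forallP uH f)) | apply: perm_inj].
  - apply: contra nH => /has_disjoint_edgesP[es [ses esH pes]].
    apply/has_disjoint_edgesP; exists (map (fun e : {set 'I_n} => k.1^-1%g @: e) es).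
    split; first by rewrite size_map.
      by move=> _ /mapP[e /esH/imsetP[f fH ->] ->]; rewrite gK.
    rewrite pairwise_map; apply: sub_pairwise pes => e f /= dis.
    rewrite -setI_eq0 -imsetI; last by move=> ? ? _ _; apply: perm_inj.
    by move: dis; rewrite -setI_eq0 => /eqP ->; rewrite imset0.
  move=> _ /imsetP[[[c' k'] z'] _ ->] neq.
  set D := diffs _ _.
  (* With fewer than [t] agreements, [D] has more than [s] points. Otherwise the words share gadget
     and translation, and a block on which their [z] differ cannot meet [~: D]. *)
  have [tD|Dt] := leqP t #|~: D|; last first.
    by left; have := cardsC D; rewrite card_ord; move: Dt; rewrite /t; lia.
  have [|ec ek ez] := xA (~: D) c k z c' k' z' tD.
    move=> i; rewrite !inE negbK => /eqP.
    exact: (wA (c, k, z) (c', k', z')).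
  right; have [j zj] : exists j, z j != z' j.
    apply/existsP; apply: contraNT neq => /existsPn zz'.
    rewrite ec ek; apply/eqP; congr (w (_, _)); apply/ffunP=> j.
    by apply/eqP/negPn.
  exists (B k j); first by apply/imsetP; exists (val j); rewrite ?(valP j).
  rewrite -[D]setCK -disjoints_subset -setI_eq0.
  by apply: contraNT zj => /ez ->.
have : #|C| <= max_focal_free r q n by apply: leq_bigmax_cond.
rewrite -(leq_pmul2l (prime_gt0 p_pr)); apply: leq_trans.
rewrite cC -/t; move: cP; move: (_ ^ t) #|P| => a b ab.
by rewrite [kappa * _]mulnC -[b * _ * _]mulnA [leqRHS]mulnA leq_mul2r ab orbT.
Qed.
End Lower.

(** * The limit *)

From mathcomp Require Import all_classical all_reals all_analysis.

Import numFieldNormedType.Exports.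

Local Open Scope classical_set_scope.
Local Open Scope ring_scope.

Lemma natr_gt_eventually (R : realType) (a : R) :
  exists k : nat, forall q, (k <= q)%N -> a < q%:R.
Proof.
exists (Num.truncn a).+1 => q kq; apply: lt_le_trans (truncnS_gt a) _.
by rewrite ler_nat.
Qed.

Lemma bernoulli_ge (R : realDomainType) (x : R) t : 0 <= x <= 1 ->
  1 - t%:R * x <= (1 - x) ^+ t.
Proof.
move=> /andP[x0 x1]; elim: t => [|t IH]; first by rewrite mul0r subr0 expr0.
rewrite exprS; apply: le_trans (_ : (1 - x) * (1 - t%:R * x) <= _).
  have := mulr_ge0 (mulr_ge0 (ler0n R t) x0) x0; rewrite -natr1; nra.
by apply: ler_wpM2l IH; rewrite subr_ge0.
Qed.

Lemma ceil_natr_div (a k u : nat) : (0 < k)%N -> (a <= u * k)%N ->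
  (u * k < a + k)%N -> Num.ceil (a%:R / k%:R : rat) = u%:Z.
Proof.
move=> k0 auk uka; apply: ceil_def.
have kQ : 0 < k%:R :> rat by rewrite ltr0n.
rewrite ltr_pdivlMr // ler_pdivrMr // intrD rmorphN /= -!pmulrn -natrM ler_nat auk andbT.
by rewrite mulrBl mul1r -natrM ltrBlDr -natrD ltr_nat.
Qed.

(** (r-2)n/(r-1) is n - n/(r-1), and the ceiling becomes a floor on the subtracted quotient. *)
Lemma focal_exponentE (r n : nat) : (2 <= r)%N ->
  focal_exponent r n = (n - n %/ (r - 1))%N.
Proof.
move=> r2; rewrite /focal_exponent.
have k0 : (0 < r - 1)%N by lia.
have sn : (n %/ (r - 1) <= n)%N by apply: leq_div.
have dn := divn_eq n (r - 1); have mn := ltn_pmod n k0.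
by rewrite (@ceil_natr_div _ _ (n - n %/ (r - 1))) //; nia.
Qed.

Lemma eventually_le_ratio (R : realType) (r n s lam : nat) (e : R) :
  (2 <= r)%N -> (0 < lam)%N -> (lam <= r.-1)%N -> (n + lam = r.-1 * s.+1)%N ->
  (s < n)%N -> 0 < e ->
  exists k : nat, forall q, (k <= q)%N ->
    (max_focal_free r q n)%:R / q%:R ^+ (n - s) <
    'C(n, s)%:R / ('C(n, s)%:R - (max_uniform_edges n s lam)%:R) + e :> R.
Proof.
move=> r2 lam0 lamr nlam sn e0.
have lams : (lam * s <= n)%N by nia.
have mC := max_uniform_edges_lt lam0 lams.
set c := 'C(n, s); set m := max_uniform_edges n s lam in mC *.
have cm0 : 0 < c%:R - m%:R :> R by rewrite subr_gt0 ltr_nat.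
(* The bad words add at most D/q to the ratio. *)
pose D : R := 'C(n, s.+1)%:R * c%:R / (c%:R - m%:R).
have D0 : 0 <= D by rewrite divr_ge0 ?mulr_ge0 ?ler0n // ltW.
have [k kP] := natr_gt_eventually (D / e); exists k.+1 => q kq.
have q0 : 0 < q%:R :> R by rewrite ltr0n; lia.
have upper : (max_focal_free r q n * (c - m) <=
    c * q ^ (n - s) + 'C(n, s.+1) * q ^ (n - s.+1) * c)%N.
  rewrite /max_focal_free; have [|C Cfree ->] := @eq_bigmax_cond _
    [pred C : {set word n q} | focal_free r C] (fun C => #|C|).
    apply/card_gt0P; exists finset.set0; rewrite inE; apply/forallP=> X.
    apply/implyP; rewrite finset.subset0 => /eqP ->; apply/existsP=> -[x0].
    by rewrite /focal_code_with_focus inE andbF.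
  exact: (card_focal_free r2 lam0 lamr nlam Cfree).
have {}upper : (max_focal_free r q n)%:R * (c%:R - m%:R) <=
    c%:R * q%:R ^+ (n - s) + 'C(n, s.+1)%:R * q%:R ^+ (n - s.+1) * c%:R :> R.
  by rewrite -natrB ?(ltnW mC) // -!natrX -!natrM -natrD ler_nat.
have qt0 : 0 < q%:R ^+ (n - s) :> R by rewrite exprn_gt0.
rewrite ltr_pdivrMr //.
have Dq : D < e * q%:R by rewrite mulrC -ltr_pdivrMr // kP // ltnW.
rewrite -(ltr_pM2r cm0); apply: le_lt_trans upper _.
rewrite [ltRHS]mulrAC mulrDl divfK ?(gt_eqF cm0) // mulrDl ltrD2l.
have -> : (n - s = (n - s.+1).+1)%N by lia.
rewrite exprS; set Q := _ ^+ _; have Q0 : 0 < Q by rewrite exprn_gt0.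
have -> : 'C(n, s.+1)%:R * Q * c%:R = D * ((c%:R - m%:R) * Q).
  by rewrite mulrA divfK ?gt_eqF // mulrAC.
have -> : e * (c%:R - m%:R) * (q%:R * Q) = e * q%:R * ((c%:R - m%:R) * Q) by ring.
by rewrite ltr_pM2r // mulr_gt0.
Qed.

Lemma hits_count_exists (n s lam : nat) : (0 < lam)%N -> (s <= n)%N ->
  exists v, (v * 'C(n, s) = n`! * max_uniform_edges n s lam)%N.
Proof.
move=> lam0 sn; have [H [uH _ <-]] := max_uniform_edges_attained n s lam0.
have [|S _ cS] := @exists_subset_card 'I_n [set: 'I_n]%SET s.
  by rewrite cardsT card_ord.
by exists #|hits H S|; apply: card_hits.
Qed.

(** Since v/f = m/c, the quotient of the two sides without [b] tends to c/(c-m) as [M] grows. *)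
Lemma density_exists (R : realType) (f c m v : nat) (b : R) :
  (0 < f)%N -> (m < c)%N -> (v * c = f * m)%N -> b < c%:R / (c%:R - m%:R) ->
  exists M : nat, b * ((f - v) * M ^ m + v * M ^ m.-1)%N%:R < (f * M ^ m)%N%:R.
Proof.
move=> f0 mc vc bl.
have cm0 : 0 < c%:R - m%:R :> R by rewrite subr_gt0 ltr_nat.
have c0 : 0 < c%:R :> R by rewrite ltr0n; lia.
move: bl; rewrite ltr_pdivlMr // -subr_gt0 => gap.
(* The bound comes from solving b((c-m)M + m) < cM for [M]. *)
have [k kP] := natr_gt_eventually (b * m%:R / (c%:R - b * (c%:R - m%:R))).
exists k.+1; have := kP k.+1 (leqnSn k); rewrite ltr_pdivrMr //.
set M := k.+1 => lowM.
have vf : (v <= f)%N by nia.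
have M0 : 0 < M%:R :> R by rewrite ltr0n.
(* The factor [m] absorbs the truncated exponent: at [m = 0] both sides vanish. *)
have MM : M%:R * (m * M ^ m.-1)%N%:R = (m * M ^ m)%N%:R :> R.
  by rewrite -natrM; congr _%:R; case: (m) => [|d]; rewrite ?mul0n ?muln0 //= expnS; nia.
have vc' : v%:R * c%:R = f%:R * m%:R :> R by rewrite -!natrM vc.
have X0 : 0 < (M ^ m)%N%:R :> R by rewrite ltr0n expn_gt0.
rewrite -(ltr_pM2r (mulr_gt0 c0 M0)).
set L := (_ + _)%N.
have -> : b * L%:R * (c%:R * M%:R) =
    f%:R * (M ^ m)%N%:R * (b * ((c%:R - m%:R) * M%:R + m%:R)).
  have LE : c%:R * L%:R =
      f%:R * ((c%:R - m%:R) * (M ^ m)%N%:R + (m * M ^ m.-1)%N%:R) :> R.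
    rewrite /L natrD !natrM natrB // mulrDr [c%:R * (v%:R * _)]mulrA.
    rewrite [c%:R * v%:R]mulrC vc' [c%:R * (_ * _)]mulrA mulrBr [c%:R * v%:R]mulrC vc'.
    by ring.
  have -> : b * L%:R * (c%:R * M%:R) = b * M%:R * (c%:R * L%:R) by ring.
  rewrite LE.
  have -> : b * M%:R * (f%:R * ((c%:R - m%:R) * (M ^ m)%N%:R + (m * M ^ m.-1)%N%:R))
    = b * f%:R * ((c%:R - m%:R) * M%:R * (M ^ m)%N%:R + M%:R * (m * M ^ m.-1)%N%:R).
    by ring.
  by rewrite MM natrM; ring.
have fX0 : 0 < f%:R * (M ^ m)%N%:R :> R by apply: mulr_gt0 X0; rewrite ltr0n.
rewrite [in ltRHS]natrM ltr_pM2l // -subr_gt0.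
move: lowM; rewrite -subr_gt0 => lowM; apply: lt_le_trans lowM _.
by rewrite le_eqVlt; apply/orP; left; apply/eqP; ring.
Qed.

(** [M] is fixed first for the density. Then [kappa] is [p %/ L], with [p] a prime so large that the
    rounding fits into the gap [G - b * L]. *)
Lemma packing_parameters_exist (R : realType) (f c m v b0 : nat) (b : R) :
  (0 < f)%N -> (m < c)%N -> (v * c = f * m)%N -> 0 <= b ->
  b < c%:R / (c%:R - m%:R) ->
  exists M p kappa : nat, [/\ prime p, (b0 < p)%N,
    (kappa * ((f - v) * M ^ m + v * M ^ m.-1) <= p)%N &
    b * p%:R < (kappa * (f * M ^ m))%N%:R].
Proof.
move=> f0 mc vc b_ge0 bl; have [M] := density_exists f0 mc vc bl.
have vf : (v <= f)%N by nia.
move=> LG; exists M.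
have L_gt0 : (0 < f * M ^ m)%N -> (0 < (f - v) * M ^ m + v * M ^ m.-1)%N.
  rewrite muln_gt0 f0 => Mm; have Mm1 : (0 < M ^ m.-1)%N.
    by move: Mm; rewrite !expn_gt0 => /orP[->|/eqP ->] //; rewrite orbT.
  by move: Mm Mm1; move: (M ^ m)%N (M ^ m.-1)%N => x y; nia.
move: L_gt0 LG; move: (_ + _)%N (f * M ^ m)%N => L G L_gt0 LG.
have G0 : (0 < G)%N by case: (posnP G) LG => // ->; rewrite ltNge mulr_ge0.
have L0 := L_gt0 G0.
have gap : 0 < G%:R - b * L%:R by rewrite subr_gt0.
have [k kP] := natr_gt_eventually (G%:R * L%:R / (G%:R - b * L%:R)).
have [p p_gt p_pr] := prime_above (maxn k b0).
move: p_gt; rewrite gtn_max => /andP[p_k p_b0].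
exists p, (p %/ L)%N; split=> //; first exact: leq_trunc_div.
have := kP p (ltnW p_k); rewrite ltr_pdivrMr // => pbig.
have LR : 0 < L%:R :> R by rewrite ltr0n.
have kL : p%:R <= (p %/ L)%N%:R * L%:R + L%:R :> R.
  by rewrite -natrM -natrD ler_nat {1}(divn_eq p L) leq_add2l ltnW // ltn_pmod.
have GR : 0 < G%:R :> R by rewrite ltr0n.
have : G%:R * p%:R <= G%:R * ((p %/ L)%N%:R * L%:R + L%:R) :> R.
  by rewrite ler_pM2l.
rewrite -(ltr_pM2r LR) natrM mulrDr; move: pbig; rewrite mulrBr.
move: (p %/ L)%N%:R => u; lra.
Qed.

(** [N] is the largest integer up to [q %/ P] that is 1 modulo [f]. *)
Lemma coprime_alphabet_exists (f P q : nat) : (0 < f)%N -> (0 < P)%N ->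
  (P * (f + 2) <= q)%N ->
  exists N, [/\ (1 < N)%N, coprime N f, (N * P <= q)%N &
    (q <= N * P + P * (f + 1))%N].
Proof.
move=> f0 P0 qbig; exists ((q %/ P).-1 %/ f * f + 1)%N.
have qP : (f + 2 <= q %/ P)%N by rewrite leq_divRL // mulnC.
have j0 : (0 < (q %/ P).-1 %/ f)%N by rewrite divn_gt0 //; lia.
have dq := divn_eq q P; have mq := ltn_pmod q P0.
have df := divn_eq (q %/ P).-1 f; have mf := ltn_pmod (q %/ P).-1 f0.
split.
- by nia.
- by rewrite coprime_sym /coprime gcdnMDl gcdn1.
- by rewrite -leq_divRL //; lia.
- by nia.
Qed.

(** By Bernoulli, (W/q)^t is at least 1 - tc/q, so a bounded loss in alphabet size disappears in the
    limit. *)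
Lemma eventually_gt_ratio (R : realType) (b delta : R) (c t : nat) :
  0 <= b -> b < delta ->
  exists k : nat, forall q W F : nat, (k <= q)%N -> (q <= W + c)%N ->
    delta * W%:R ^+ t <= F%:R -> b < F%:R / q%:R ^+ t.
Proof.
move=> b0 b_delta.
have [k kP] := natr_gt_eventually (delta * t%:R * c%:R / (delta - b)).
exists (maxn k c.+1) => q W F; rewrite geq_max => /andP[kq cq] qW lowF.
have qR : 0 < q%:R :> R by rewrite ltr0n; lia.
have d0 : 0 < delta by apply: le_lt_trans b0 _.
rewrite ltr_pdivlMr ?exprn_gt0 //; apply: lt_le_trans lowF.
have ratio : 1 - c%:R / q%:R <= W%:R / q%:R :> R.
  by rewrite ler_pdivlMr // mulrBl mul1r divfK ?gt_eqF // lerBlDr -natrD ler_nat.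
have -> : W%:R = W%:R / q%:R * q%:R :> R by rewrite divfK ?gt_eqF.
rewrite exprMn mulrA ltr_pM2r ?exprn_gt0 //.
have x01 : 0 <= (c%:R / q%:R : R) <= 1.
  by rewrite divr_ge0 //= ler_pdivrMr // mul1r ler_nat ltnW.
apply: (@lt_le_trans _ _ (delta * (1 - t%:R * (c%:R / q%:R)))).
  have := kP q kq; rewrite ltr_pdivrMr ?subr_gt0 // => big.
  have -> : delta * (1 - t%:R * (c%:R / q%:R)) = (delta * q%:R - delta * t%:R * c%:R) / q%:R.
    by field; rewrite gt_eqF.
  by rewrite ltr_pdivlMr //; lra.
rewrite ler_pM2l //; apply: le_trans (bernoulli_ge _ x01) _.
apply: lerXn2r => //; rewrite nnegrE; first by case/andP: x01; rewrite subr_ge0.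
by rewrite divr_ge0.
Qed.

Lemma eventually_ge_ratio (R : realType) (r n s lam : nat) (b : R) :
  (2 <= r)%N -> (0 < lam)%N -> (lam <= r.-1)%N -> (n + lam = r.-1 * s.+1)%N ->
  (s < n)%N ->
  b < 'C(n, s)%:R / ('C(n, s)%:R - (max_uniform_edges n s lam)%:R) ->
  exists k : nat, forall q, (k <= q)%N ->
    b < (max_focal_free r q n)%:R / q%:R ^+ (n - s).
Proof.
move=> r2 lam0 lamr nlam sn bl; have [b0|b0] := ltP b 0.
  by exists 0%N => q _; apply: lt_le_trans b0 _; rewrite divr_ge0 ?exprn_ge0.
have lams : (lam * s <= n)%N by nia.
have mC := max_uniform_edges_lt lam0 lams.
have [v vP] := hits_count_exists lam0 (ltnW sn).
have [M [p [kappa [p_pr p_gt cap dens]]]] :=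
  packing_parameters_exist (2 * n) (fact_gt0 n) mC vP b0 bl.
have pR : 0 < p%:R :> R by rewrite ltr0n prime_gt0.
rewrite -ltr_pdivlMr // in dens.
have P0 : (0 < p ^ #|sample n|)%N by rewrite expn_gt0 prime_gt0.
have low q N (N1 : (1 < N)%N) (Ncop : coprime N n`!) :=
  max_focal_free_ge (q := q) r2 lam0 lamr nlam sn p_pr p_gt N1 Ncop vP cap.
move: low P0; move: (p ^ #|sample n|)%N => P low P0.
have [k kP] := eventually_gt_ratio (P * (n`! + 1)) (n - s) b0 dens.
exists (maxn k (P * (n`! + 2))) => q; rewrite geq_max => /andP[kq Pq].
have [N [N1 Ncop NP qNP]] := coprime_alphabet_exists (fact_gt0 n) P0 Pq.
apply: (kP q (N * P)%N) => //; have := low q N N1 Ncop NP.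
rewrite -mulnA mulrAC ler_pdivrMr // -natrX -!natrM ler_nat.
by rewrite mulnC [X in (_ <= X)%N -> _]mulnC.
Qed.

Theorem theorem1p5 (R : realType) (r n lam : nat)
    (hr : (3 <= r)%N) (hn : (2 <= n)%N)
    (hlam : (1 <= lam <= r - 1)%N) (hmod : n + lam = 0 %[mod r - 1]) :
  (fun q : nat =>
     (max_focal_free r q n)%:R / q%:R ^+ focal_exponent r n : R) @ \oo -->
  ('C(n, focal_exponent r n)%:R /
     ('C(n, focal_exponent r n)%:R
        - (max_uniform_edges n (n %/ (r - 1)) lam)%:R) : R).
Proof.
have r2 : (2 <= r)%N by lia.
have [lam0 lamr] : (0 < lam)%N /\ (lam <= r.-1)%N by lia.
rewrite focal_exponentE //; set s := (n %/ (r - 1))%N.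
have k2 : (2 <= r - 1)%N by lia.
have sn : (s < n)%N by rewrite /s ltn_Pdiv //; lia.
have nlam : (n + lam = r.-1 * s.+1)%N.
  have k0 : (0 < r - 1)%N by lia.
  have dn := divn_eq n (r - 1); have mn := ltn_pmod n k0.
  have : (n %% (r - 1) + lam = 0 %[mod r - 1])%N by rewrite modnDml.
  rewrite mod0n => /eqP/dvdnP[d dE].
  (* The remainder is below [r - 1] and [lam] lies between 1 and [r - 1], so their sum is a multiple
     of [r - 1] strictly between 0 and 2(r-1). *)
  have d1 : d = 1%N by nia.
  rewrite -subn1 -/s in dn *; nia.
rewrite bin_sub ?(ltnW sn) //; apply/cvgrPdist_lt => e e0.
have [k kP] := eventually_le_ratio r2 lam0 lamr nlam sn e0.
have [|k' k'P] := @eventually_ge_ratio R r n s lam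
  ('C(n, s)%:R / ('C(n, s)%:R - (max_uniform_edges n s lam)%:R) - e)
  r2 lam0 lamr nlam sn; first by rewrite ltrBlDr ltrDl.
exists (maxn k k') => // q /=; rewrite geq_max => /andP[/kP up /k'P low].
by rewrite ltr_distlC; apply/andP; split.
Qed.
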